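(* Let $k$ be a field of characteristic $p>0$, and let $m,r\ge0$ be integers. Every operation $H^{m+1,m}\to H^{r,r}$ on fields over $k$ is constant. In particular, every normalized operation is zero.
   Context: For a field $F$ of characteristic $p>0$, $\Omega^j_F=\Omega^j_{F/\mathbf Z}$ denotes the absolute differential $j$-forms (zero for $j<0$). Let $\mathcal P:\Omega^j_F\to\Omega^j_F/d\Omega^{j-1}_F$ be the group homomorphism with $\mathcal P(a\frac{db_1}{b_1}\wedge\cdots\wedge\frac{db_j}{b_j})=(a^p-a)\frac{db_1}{b_1}\wedge\cdots\wedge\frac{db_j}{b_j}$. $H^{i,j}(F)$ denotes the mod $p$ étale motivic cohomology group $H^i_{\mathrm{et}}(F,\mathbf Z/p(j))$; concretely $H^{j,j}(F)=\ker\mathcal P$, which is the subgroup of $\Omega^j_F$ generated by the forms $\frac{db_1}{b_1}\wedge\cdots\wedge\frac{db_j}{b_j}$ ($b_i\in F^*$); $H^{j+1,j}(F)=\operatorname{coker}\mathcal P$. These are functorial in $F$ by pullback of forms. An operation $H^{a,b}\to H^{c,d}$ on fields over $k$ is a natural transformation of functors from fields over $k$ to sets (not assumed additive). It is constant if it is given by the pullback of a fixed element of $H^{c,d}(k)$, and normalized if it sends $0$ to $0$. *)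

(* Defs.v *)
From HB Require Import structures.
From mathcomp Require Import all_boot all_order all_algebra.
From mathcomp Require Import ring_quotient finmap.
From mathcomp Require Import boolp ring.
From mathcomp.multinomials Require Import monalg.

Set Implicit Arguments.
Unset Strict Implicit.
Unset Printing Implicit Defensive.

Import GRing.Theory.
Local Open Scope ring_scope.
Local Open Scope quotient_scope.

(* [Omega F j] is the j-th exterior power over F of the module of absolute
   Kaehler differentials of F, presented by generators and relations: it is the
   F-vector space on the symbols db_1 /\ ... /\ db_j, with b : {ffun 'I_j -> F},
   subject to additivity and the Leibniz rule in each slot, and to the
   vanishing of a symbol with two equal entries.  (Vanishing of
   w_1 /\ ... /\ w_j for arbitrary repeated 1-forms follows by polarization.)
   Lemma [Omega_universal] is the universal property. *)

Section Presentation.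
Variables (F : fieldType) (j : nat).

Definition upd (b : {ffun 'I_j -> F}) (i : 'I_j) (x : F) : {ffun 'I_j -> F} :=
  [ffun l => if l == i then x else b l].

Variant form_rel : {malg F[{ffun 'I_j -> F}]} -> Prop :=
| FormAdd b i x y :
    form_rel (<< upd b i (x + y) >> - << upd b i x >> - << upd b i y >>)
| FormLeibniz b i x y :
    form_rel (<< upd b i (x * y) >>
              - << x *g upd b i y >> - << y *g upd b i x >>)
| FormAlt (b : {ffun 'I_j -> F}) i l : i != l -> b i = b l ->
    form_rel << b >>.

Inductive form_span : {malg F[{ffun 'I_j -> F}]} -> Prop :=
| FormSpan0 : form_span 0
| FormSpanD c r x : form_rel r -> form_span x -> form_span (c *: r + x).

Definition form_submod : {pred {malg F[{ffun 'I_j -> F}]}} :=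
  fun x => `[< form_span x >].

Lemma form_spanD x y : form_span x -> form_span y -> form_span (x + y).
Proof.
move=> sx sy; elim: sx => [|c r z hr _ ih]; first by rewrite add0r.
by rewrite -addrA; apply: FormSpanD.
Qed.

Lemma form_spanZ c x : form_span x -> form_span (c *: x).
Proof.
elim=> [|d r z hr _ ih]; first by rewrite scaler0; exact: FormSpan0.
by rewrite scalerDr scalerA; apply: FormSpanD.
Qed.

Lemma form_rel_span r : form_rel r -> form_span r.
Proof.
by move=> hr; rewrite -[r]scale1r -[_ *: r]addr0; apply: FormSpanD => //;
  exact: FormSpan0.
Qed.

Lemma form_submod_zmod_closed : zmod_closed form_submod.
Proof.
split=> [|x y /asboolP sx /asboolP sy]; apply/asboolP; first exact: FormSpan0.
by apply: form_spanD => //; rewrite -scaleN1r; apply: form_spanZ.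
Qed.

HB.instance Definition _ :=
  GRing.isZmodClosed.Build _ form_submod form_submod_zmod_closed.

Definition Omega : Type := Quotient.quot form_submod.
HB.instance Definition _ := GRing.Zmodule.on Omega.

Definition Omega_pi (x : {malg F[{ffun 'I_j -> F}]}) : Omega :=
  \pi_(Quotient.quot form_submod) x.

Lemma Omega_pi_is_zmod_morphism : zmod_morphism Omega_pi.
Proof. by move=> x y; rewrite /Omega_pi raddfB. Qed.

HB.instance Definition _ :=
  GRing.isZmodMorphism.Build _ Omega Omega_pi Omega_pi_is_zmod_morphism.

Definition Omega_repr (x : Omega) : {malg F[{ffun 'I_j -> F}]} :=
  repr (x : Quotient.quot form_submod).

Lemma Omega_reprK : cancel Omega_repr Omega_pi.
Proof. by move=> x; rewrite /Omega_pi /Omega_repr reprK. Qed.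

Lemma Omega_pi_eq x y : Omega_pi x = Omega_pi y <-> form_span (x - y).
Proof.
split=> [h|h]; last by apply/eqP; rewrite /Omega_pi -Quotient.idealrBE;
  apply/asboolP.
by apply/asboolP; change (x - y \in form_submod);
  rewrite Quotient.idealrBE; apply/eqP.
Qed.

Definition Omega_scale (c : F) (x : Omega) : Omega :=
  Omega_pi (c *: Omega_repr x).

Lemma Omega_scale_pi c x : Omega_scale c (Omega_pi x) = Omega_pi (c *: x).
Proof.
apply/Omega_pi_eq; rewrite -scalerBr; apply: form_spanZ.
by apply/Omega_pi_eq; rewrite Omega_reprK.
Qed.

Lemma Omega_scaleA a b x :
  Omega_scale a (Omega_scale b x) = Omega_scale (a * b) x.
Proof. by rewrite -[x]Omega_reprK !Omega_scale_pi scalerA. Qed.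

Lemma Omega_scale1 : left_id 1 Omega_scale.
Proof. by move=> x; rewrite -[x]Omega_reprK Omega_scale_pi scale1r. Qed.

Lemma Omega_scaleDr : right_distributive Omega_scale +%R.
Proof.
move=> a x y; rewrite -[x]Omega_reprK -[y]Omega_reprK -raddfD.
by rewrite !Omega_scale_pi scalerDr raddfD.
Qed.

Lemma Omega_scaleDl x : {morph Omega_scale^~ x : a b / a + b}.
Proof.
by move=> a b; rewrite -[x]Omega_reprK !Omega_scale_pi scalerDl raddfD.
Qed.

HB.instance Definition _ := GRing.Zmodule_isLmodule.Build F Omega
  Omega_scaleA Omega_scale1 Omega_scaleDr Omega_scaleDl.

(* a db_1 /\ ... /\ db_j *)
Definition form (a : F) (b : {ffun 'I_j -> F}) : Omega :=
  Omega_pi << a *g b >>.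

(* a (db_1 / b_1) /\ ... /\ (db_j / b_j), meant for nonzero b_i *)
Definition dlog_form (a : F) (b : {ffun 'I_j -> F}) : Omega :=
  form (a / \prod_i b i) b.

Lemma formD a a' b : form (a + a') b = form a b + form a' b.
Proof. by rewrite /form monalgUD raddfD. Qed.

Lemma form0 b : form 0 b = 0.
Proof. by rewrite /form monalgU0 raddf0. Qed.

Lemma scale_malgU (c a : F) (b : {ffun 'I_j -> F}) :
  c *: << a *g b >> = << c * a *g b >>.
Proof.
by apply/malgP => k; rewrite mcoeffZ !mcoeffU mulrnAr.
Qed.

Lemma scale_form c a b : c *: form a b = form (c * a) b.
Proof. by rewrite /form -scale_malgU; exact: Omega_scale_pi. Qed.

Lemma formN a b : form (- a) b = - form a b.
Proof. by rewrite -mulN1r -scale_form scaleN1r. Qed.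

Lemma form_addr a b i x y :
  form a (upd b i (x + y)) = form a (upd b i x) + form a (upd b i y).
Proof.
rewrite /form -raddfD; apply/Omega_pi_eq; rewrite opprD addrA.
have := form_spanZ a (form_rel_span (FormAdd b i x y)).
by rewrite !scalerBr !scale_malgU !mulr1.
Qed.

Lemma form_mulr a b i x y :
  form a (upd b i (x * y)) =
  form (a * x) (upd b i y) + form (a * y) (upd b i x).
Proof.
rewrite /form -raddfD; apply/Omega_pi_eq; rewrite opprD addrA.
have := form_spanZ a (form_rel_span (FormLeibniz b i x y)).
by rewrite !scalerBr !scale_malgU !mulr1.
Qed.

Lemma form_alt a (b : {ffun 'I_j -> F}) i l : i != l -> b i = b l -> form a b = 0.
Proof.
move=> il e; rewrite -[RHS](raddf0 Omega_pi); apply/Omega_pi_eq.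
rewrite subr0; have := form_spanZ a (form_rel_span (FormAlt il e)).
by rewrite scale_malgU mulr1.
Qed.

Lemma Omega_ind (P : Omega -> Prop) :
  P 0 -> (forall a b x, P x -> P (form a b + x)) -> forall x, P x.
Proof.
move=> P0 PD x; rewrite -[x]Omega_reprK (monalgE (Omega_repr x)) raddf_sum.
by elim/big_rec: _ => //= b y _; apply: PD.
Qed.

(* The conditions under which a db_1 /\ ... /\ db_j |-> u a b extends to an
   additive, not necessarily F-linear, map on Omega; see [Omega_lift_form]. *)
Record form_map (V : zmodType) (u : F -> {ffun 'I_j -> F} -> V) : Prop :=
  FormMap {
    fm_coef : forall a a' b, u (a + a') b = u a b + u a' b;
    fm_add : forall a b i x y,
      u a (upd b i (x + y)) = u a (upd b i x) + u a (upd b i y);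
    fm_leibniz : forall a b i x y,
      u a (upd b i (x * y)) = u (a * x) (upd b i y) + u (a * y) (upd b i x);
    fm_alt : forall a (b : {ffun 'I_j -> F}) i l,
      i != l -> b i = b l -> u a b = 0 }.

Section Lift.
Variables (V : zmodType) (u : F -> {ffun 'I_j -> F} -> V).

Definition malg_lift (x : {malg F[{ffun 'I_j -> F}]}) : V :=
  \sum_(b <- msupp x) u x@_b b.

Definition Omega_lift (x : Omega) : V := malg_lift (Omega_repr x).

Hypothesis hu : form_map u.

Lemma fm_coef0 b : u 0 b = 0.
Proof. by apply: (addrI (u 0 b)); rewrite -(fm_coef hu) !addr0. Qed.

Lemma malg_liftE (D : seq {ffun 'I_j -> F}) x :
  uniq D -> {subset msupp x <= D} -> malg_lift x = \sum_(b <- D) u x@_b b.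
Proof.
move=> uD sD; rewrite /malg_lift [RHS](bigID (fun b => b \in msupp x)) /=.
rewrite [X in _ = _ + X]big1 ?addr0; last first.
  by move=> b /mcoeff_outdom ->; rewrite fm_coef0.
rewrite -[RHS]big_filter; apply: perm_big; apply: uniq_perm.
- exact: fset_uniq.
- exact: filter_uniq.
by move=> b; rewrite mem_filter; case: (boolP (b \in msupp x)) => // /sD ->.
Qed.

Lemma malg_liftD x y : malg_lift (x + y) = malg_lift x + malg_lift y.
Proof.
pose D := undup (msupp x ++ msupp y).
have uD : uniq D by exact: undup_uniq.
rewrite !(@malg_liftE D) // -?big_split /=.
- by apply: eq_bigr => b _; rewrite mcoeffD (fm_coef hu).
- by move=> b hb; rewrite mem_undup mem_cat hb orbT.
- by move=> b hb; rewrite mem_undup mem_cat hb.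
move=> b; rewrite mem_undup mem_cat -mcoeff_neq0 mcoeffD.
apply: contraR; rewrite negb_or => /andP[hx hy].
by rewrite !mcoeff_outdom ?addr0.
Qed.

Lemma malg_liftU a b : malg_lift << a *g b >> = u a b.
Proof.
rewrite (@malg_liftE [:: b]) // ?big_seq1 ?mcoeffUU // => c.
by rewrite inE -mcoeff_neq0 mcoeffU [b == c]eq_sym; case: (eqVneq c b);
  rewrite // mulr0n eqxx.
Qed.

Lemma malg_lift0 : malg_lift 0 = 0.
Proof. by apply: (addrI (malg_lift 0)); rewrite -malg_liftD !addr0. Qed.

Lemma malg_liftN x : malg_lift (- x) = - malg_lift x.
Proof.
by apply: (addrI (malg_lift x)); rewrite -malg_liftD !subrr malg_lift0.
Qed.

Lemma malg_lift_span x : form_span x -> malg_lift x = 0.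
Proof.
elim=> [|c r y hr _ ih]; first exact: malg_lift0.
rewrite malg_liftD ih addr0.
case: hr => [b i z t|b i z t|b i l il e].
- rewrite !scalerBr !scale_malgU !mulr1 !malg_liftD !malg_liftN !malg_liftU.
  by rewrite (fm_add hu) -addrA -opprD subrr.
- rewrite !scalerBr !scale_malgU !mulr1 !malg_liftD !malg_liftN !malg_liftU.
  by rewrite (fm_leibniz hu) -addrA -opprD subrr.
- by rewrite scale_malgU malg_liftU (fm_alt hu _ il e).
Qed.

Lemma Omega_lift_pi x : Omega_lift (Omega_pi x) = malg_lift x.
Proof.
apply/eqP; rewrite -subr_eq0 -malg_liftN -malg_liftD.
by apply/eqP/malg_lift_span/Omega_pi_eq; exact: Omega_reprK.
Qed.

Lemma Omega_lift_form a b : Omega_lift (form a b) = u a b.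
Proof. by rewrite /form Omega_lift_pi malg_liftU. Qed.

Lemma Omega_lift_is_zmod_morphism : zmod_morphism Omega_lift.
Proof.
move=> x y; rewrite -[x]Omega_reprK -[y]Omega_reprK -raddfB.
by rewrite !Omega_lift_pi malg_liftD malg_liftN.
Qed.

Lemma Omega_liftD x y : Omega_lift (x + y) = Omega_lift x + Omega_lift y.
Proof.
rewrite -[x]Omega_reprK -[y]Omega_reprK -raddfD.
by rewrite !Omega_lift_pi malg_liftD.
Qed.

Lemma Omega_lift0 : Omega_lift 0 = 0.
Proof. by apply: (addrI (Omega_lift 0)); rewrite -Omega_liftD !addr0. Qed.

End Lift.

Lemma Omega_additive_ext (V : zmodType) (f g : {additive Omega -> V}) :
  (forall a b, f (form a b) = g (form a b)) -> f =1 g.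
Proof.
move=> h; elim/Omega_ind => [|a b x ih]; first by rewrite !raddf0.
by rewrite !raddfD h ih.
Qed.

(* Alternating multiderivations F^j -> W factor uniquely through Omega. *)
Lemma Omega_universal (W : lmodType F) (D : {ffun 'I_j -> F} -> W) :
  (forall b i x y, D (upd b i (x + y)) = D (upd b i x) + D (upd b i y)) ->
  (forall b i x y,
     D (upd b i (x * y)) = x *: D (upd b i y) + y *: D (upd b i x)) ->
  (forall (b : {ffun 'I_j -> F}) i l, i != l -> b i = b l -> D b = 0) ->
  exists! f : Omega -> W,
    (forall c x y, f (c *: x + y) = c *: f x + f y) /\
    (forall b, f (form 1 b) = D b).
Proof.
move=> Dadd Dmul Dalt; pose u a b := a *: D b.
have hu : form_map u.
  split=> [a a' b|a b i x y|a b i x y|a b i l il e]; rewrite /u.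
  - exact: scalerDl.
  - by rewrite Dadd scalerDr.
  - by rewrite Dmul scalerDr !scalerA.
  - by rewrite (Dalt _ _ _ il e) scaler0.
have lift0 := Omega_lift0 hu; have liftD := Omega_liftD hu.
exists (Omega_lift u); split; first split.
- move=> c x y; rewrite liftD; congr (_ + _).
  elim/Omega_ind: x => [|a b x ih]; first by rewrite scaler0 lift0 scaler0.
  rewrite scalerDr !liftD ih scalerDr scale_form !(Omega_lift_form hu).
  by rewrite /u scalerA.
- by move=> b; rewrite (Omega_lift_form hu) /u scale1r.
move=> g [glin gD].
have g0 : g 0 = 0.
  apply: (addrI (g 0)).
  by rewrite -[X in X + _]scale1r -glin scaler0 !addr0.
apply: funext; elim/Omega_ind => [|a b x ih]; first by rewrite lift0 g0.
rewrite liftD ih (Omega_lift_form hu) /u.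
by rewrite -[X in form X b]mulr1 -scale_form glin gD.
Qed.

End Presentation.

Arguments form {F j} a b.
Arguments dlog_form {F j} a b.

Section ExteriorDerivative.
Variable F : fieldType.

Definition fcons j (a : F) (b : {ffun 'I_j -> F}) : {ffun 'I_j.+1 -> F} :=
  [ffun i => if unlift ord0 i is Some l then b l else a].

Lemma fcons_upd j a (b : {ffun 'I_j -> F}) i x :
  fcons a (upd b i x) = upd (fcons a b) (lift ord0 i) x.
Proof.
apply/ffunP => l; rewrite !ffunE; case: (unliftP ord0 l) => [k|] ->.
  by rewrite (inj_eq (@lift_inj _ _)) ffunE.
by rewrite (negPf (neq_lift _ _)).
Qed.

Lemma fcons_upd0 j a x (b : {ffun 'I_j -> F}) :
  fcons x b = upd (fcons a b) ord0 x.
Proof.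
apply/ffunP => l; rewrite !ffunE; case: (unliftP ord0 l) => [k|] ->.
  by rewrite eq_sym (negPf (neq_lift _ _)).
by rewrite eqxx.
Qed.

Definition d_gen j (a : F) (b : {ffun 'I_j -> F}) : Omega F j.+1 :=
  form 1 (fcons a b).

Lemma d_gen_form_map j : form_map (@d_gen j).
Proof.
rewrite /d_gen.
split=> [a a' b|a b i x y|a b i x y|a b i l il e].
- by rewrite (fcons_upd0 0) form_addr -!fcons_upd0.
- by rewrite !fcons_upd form_addr.
- rewrite !fcons_upd form_mulr !mul1r.
  have eqm z t : form 1 (upd (fcons (a * z) b) (lift ord0 i) t) =
      form a (upd (fcons z b) (lift ord0 i) t) +
      form z (upd (fcons a b) (lift ord0 i) t).
    rewrite -!fcons_upd (fcons_upd0 0) form_mulr !mul1r.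
    by rewrite -!fcons_upd0.
  rewrite !eqm addrACA; set s := form a _ + form a _.
  suff -> : s = 0 by rewrite add0r addrC.
  rewrite /s.
  have alt z : form a (upd (fcons z b) (lift ord0 i) z) = 0.
    apply: (@form_alt _ _ _ _ ord0 (lift ord0 i)); first exact: neq_lift.
    by rewrite !ffunE eqxx unlift_none (negPf (neq_lift _ _)).
  have adl z w t : form a (upd (fcons (z + w) b) (lift ord0 i) t) =
      form a (upd (fcons z b) (lift ord0 i) t) +
      form a (upd (fcons w b) (lift ord0 i) t).
    by rewrite -!fcons_upd (fcons_upd0 0) form_addr -!fcons_upd0.
  by have := alt (x + y); rewrite adl !form_addr !alt add0r addr0.
- apply: (@form_alt _ _ _ _ (lift ord0 i) (lift ord0 l)).
    by rewrite (inj_eq lift_inj).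
  by rewrite !ffunE !liftK.
Qed.

Definition ext_d j : Omega F j -> Omega F j.+1 := Omega_lift (@d_gen j).

HB.instance Definition _ j := GRing.isZmodMorphism.Build _ _ (@ext_d j)
  (Omega_lift_is_zmod_morphism (@d_gen_form_map j)).

Lemma ext_dE j a (b : {ffun 'I_j -> F}) : ext_d (form a b) = form 1 (fcons a b).
Proof. by rewrite /ext_d (Omega_lift_form (@d_gen_form_map j)). Qed.

(* The subgroup d Omega^(j-1) of Omega^j, which is 0 for j = 0. *)
Definition exact_forms j : {pred Omega F j} :=
  match j return {pred Omega F j} with
  | 0 => fun x => x == 0
  | j'.+1 => fun x => `[< exists y, x = ext_d y >]
  end.

Lemma exact_forms_zmod_closed j : zmod_closed (@exact_forms j).
Proof.
case: j => [|j]; split; rewrite ?unfold_in /=.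
- exact: eqxx.
- by move=> x y /eqP -> /eqP ->; rewrite subr0 unfold_in /=.
- by apply/asboolP; exists 0; rewrite raddf0.
- move=> x y /asboolP[z ->] /asboolP[t ->]; apply/asboolP.
  by exists (z - t); rewrite raddfB.
Qed.

HB.instance Definition _ j :=
  GRing.isZmodClosed.Build _ (@exact_forms j) (@exact_forms_zmod_closed j).

Definition Omega_mod_exact j : zmodType := Quotient.quot (@exact_forms j).

Definition mod_exact {j} : {additive Omega F j -> Omega_mod_exact j} :=
  \pi_(Quotient.quot (@exact_forms j)).

Lemma mod_exact_eq0 j x : (@mod_exact j x == 0) = (x \in @exact_forms j).
Proof. by rewrite -(raddf0 (@mod_exact j)) -Quotient.idealrBE subr0. Qed.

Lemma mod_exact_form1 j (i0 : 'I_j) (b : {ffun 'I_j -> F}) :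
  mod_exact (form 1 b) = 0.
Proof.
case: j i0 b => [[]//|j] _ b.
apply/eqP; rewrite mod_exact_eq0; apply/asboolP.
exists (form (b ord0) [ffun i => b (lift ord0 i)]); rewrite ext_dE.
congr form; apply/ffunP => i; rewrite !ffunE.
by case: (unliftP ord0 i) => [l|] ->; rewrite ?ffunE.
Qed.

End ExteriorDerivative.

Arguments mod_exact {F j}.

Section Derivations.
Variables (F : fieldType) (p : nat) (hp : p \in [pchar F]).
Variables (V : lmodType F) (D : F -> V).
Hypothesis DD : forall x y, D (x + y) = D x + D y.
Hypothesis DM : forall x y, D (x * y) = x *: D y + y *: D x.

Lemma der0 : D 0 = 0.
Proof. by apply: (addrI (D 0)); rewrite -DD !addr0. Qed.

Lemma der1 : D 1 = 0.
Proof. by apply: (addrI (D 1)); rewrite addr0 -{3}[1]mulr1 DM !scale1r. Qed.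

Lemma der_sum I (r : seq I) (f : I -> F) :
  D (\sum_(i <- r) f i) = \sum_(i <- r) D (f i).
Proof.
elim: r => [|i r ih]; first by rewrite !big_nil der0.
by rewrite !big_cons DD ih.
Qed.

Lemma derMn x n : D (x *+ n) = D x *+ n.
Proof. by elim: n => [|n ih]; rewrite ?mulr0n ?der0 // !mulrS DD ih. Qed.

Lemma derX x n : D (x ^+ n) = (x ^+ n.-1 *+ n) *: D x.
Proof.
elim: n => [|n ih]; first by rewrite expr0 der1 mulr0n scale0r.
rewrite exprS DM ih scalerA -scalerDl; congr (_ *: _).
case: n ih => [|n] _; first by rewrite mulr0n mulr0 add0r mulr1n.
by rewrite /= mulrnAr -exprS -mulrSr.
Qed.

Lemma derX_pchar x : D (x ^+ p) = 0.
Proof.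
by rewrite derX -mulr_natr (pcharf0 hp) mulr0 scale0r.
Qed.

Lemma derM0 x y : D x = 0 -> D y = 0 -> D (x * y) = 0.
Proof. by move=> hx hy; rewrite DM hx hy !scaler0 addr0. Qed.

Lemma der_prod0 I (r : seq I) (P : pred I) (f : I -> F) :
  (forall i, P i -> D (f i) = 0) -> D (\prod_(i <- r | P i) f i) = 0.
Proof.
move=> h; elim/big_rec: _ => [|i y Pi hy]; first exact: der1.
by apply: derM0 => //; apply: h.
Qed.

(* ((x + y)^p - x^p - y^p) / p *)
Definition witt_sum (x y : F) : F :=
  \sum_(1 <= n < p) (x ^+ n * y ^+ (p - n)) *+ ('C(p, n) %/ p).

Lemma der_witt_sum x y :
  D (witt_sum x y) =
  (x + y) ^+ p.-1 *: D (x + y) - x ^+ p.-1 *: D x - y ^+ p.-1 *: D y.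
Proof.
have pp : prime p := pcharf_prime hp.
have p0 : (0 < p)%N := prime_gt0 pp.
have e1 n : (0 < n < p)%N ->
    (n * ('C(p, n) %/ p) = 'C(p.-1, n.-1))%N.
  move=> /andP[n0 np]; have dv : (p %| 'C(p, n))%N.
    by apply: prime_dvd_bin; rewrite // n0 np.
  apply/eqP; rewrite -(eqn_pmul2l p0) mulnCA [(p * (_ %/ _))%N]mulnC divnK //.
  by case: n n0 np {dv} => // n _ np; rewrite mul_bin_diag.
have e2 n : (0 < n < p)%N ->
    ((p - n) * ('C(p, n) %/ p) = 'C(p.-1, n))%N.
  move=> /andP[n0 np].
  have dv : (p %| 'C(p, n))%N by apply: prime_dvd_bin; rewrite // n0 np.
  apply/eqP; rewrite -(eqn_pmul2l p0) mulnCA [(p * (_ %/ _))%N]mulnC divnK //.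
  by rewrite mul_bin_down.
have eD n : (0 < n < p)%N ->
   D ((x ^+ n * y ^+ (p - n)) *+ ('C(p, n) %/ p)) =
   (x ^+ n.-1 * y ^+ (p.-1 - n.-1) *+ 'C(p.-1, n.-1)) *: D x +
   (x ^+ n * y ^+ (p.-1 - n) *+ 'C(p.-1, n)) *: D y.
  move=> hn; have /andP[n0 np] := hn.
  rewrite derMn DM !derX !scalerA addrC mulrnDl !scalerMnl.
  have -> : (p.-1 - n.-1 = p - n)%N by rewrite -!subn1 subnBA // addnC subnKC.
  congr (_ *: _ + _ *: _).
    by rewrite -e1 // mulrnA mulrnAr [y ^+ _ * _]mulrC.
  rewrite -e2 // mulrnA mulrnAr; congr (_ *+ _ *+ _); congr (_ * _ ^+ _).
  by rewrite -!subn1 subnAC.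
rewrite /witt_sum der_sum.
rewrite (eq_big_nat _ _ eD) big_split /= -!scaler_suml.
have exy : (x + y) ^+ p.-1 =
    \sum_(0 <= n < p) (x ^+ n * y ^+ (p.-1 - n) *+ 'C(p.-1, n)).
  rewrite addrC exprDn big_mkord prednK //.
  by apply: eq_bigr => i _; rewrite mulrC.
have ex : \sum_(1 <= n < p)
     (x ^+ n.-1 * y ^+ (p.-1 - n.-1) *+ 'C(p.-1, n.-1)) =
    (x + y) ^+ p.-1 - x ^+ p.-1.
  rewrite exy big_add1 /= -[in RHS](prednK p0) big_nat_recr //= subnn expr0 mulr1.
  by rewrite binn mulr1n addrK.
have ey : \sum_(1 <= n < p) (x ^+ n * y ^+ (p.-1 - n) *+ 'C(p.-1, n)) =
    (x + y) ^+ p.-1 - y ^+ p.-1.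
  rewrite exy [in RHS]big_ltn // expr0 mul1r subn0 bin0 mulr1n.
  by rewrite addrC addrA addNr add0r.
by rewrite ex ey DD scalerDr !scalerBl addrACA addrA.
Qed.

End Derivations.

Section ArtinSchreier.
Variables (F : fieldType) (p : nat) (hp : p \in [pchar F]) (j : nat).

(* a db_1 /\ ... /\ db_j = (a b_1...b_j) db_1/b_1 /\ ... /\ db_j/b_j,
   so the formula for P becomes the following one, also valid when b_i = 0. *)
Definition P_gen (a : F) (b : {ffun 'I_j -> F}) : Omega_mod_exact F j :=
  mod_exact (form (a ^+ p * \prod_i b i ^+ p.-1) b - form a b).

Lemma prod_upd (b : {ffun 'I_j -> F}) i x n :
  \prod_l upd b i x l ^+ n = x ^+ n * \prod_(l | l != i) b l ^+ n.
Proof.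
rewrite (bigD1 i) //= ffunE eqxx; congr (_ * _).
by apply: eq_bigr => l /negPf li; rewrite ffunE li.
Qed.

Lemma upd_upd (b : {ffun 'I_j -> F}) i x y : upd (upd b i x) i y = upd b i y.
Proof. by apply/ffunP => l; rewrite !ffunE; case: (l == i). Qed.

Lemma form_upd_scale a c (b : {ffun 'I_j -> F}) i z :
  form (a * c) (upd b i z) = a *: (c *: form 1 (upd b i z)).
Proof. by rewrite !scale_form mulr1. Qed.

Lemma P_gen_form_map : form_map P_gen.
Proof.
have p0 : (0 < p)%N := prime_gt0 (pcharf_prime hp).
rewrite /P_gen.
split=> [a a' b|a b i x y|a b i x y|a b i l il e].
- rewrite -raddfD -(pFrobenius_autE hp) rmorphD /= !pFrobenius_autE.
  by rewrite mulrDl !formD opprD addrACA.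
- rewrite !prod_upd; set q := \prod_(l | _) _.
  pose D z := form 1 (upd b i z).
  have DD z t : D (z + t) = D z + D t by exact: form_addr.
  have DM z t : D (z * t) = z *: D t + t *: D z.
    by rewrite /D form_mulr !scale_form !mulr1 !mul1r.
  have D0 l : l != i -> D (b l) = 0.
    move=> li; apply: (@form_alt _ _ _ _ l i) => //.
    by rewrite !ffunE eqxx (negPf li).
  have DK : D (a ^+ p * q) = 0.
    apply: derM0 => //; first exact: (derX_pchar hp).
    apply: der_prod0 => // l li.
    by rewrite (derX DM) D0 // scaler0.
  have main : mod_exact (form (a ^+ p * ((x + y) ^+ p.-1 * q)) (upd b i (x + y))
      - form (a ^+ p * (x ^+ p.-1 * q)) (upd b i x)
      - form (a ^+ p * (y ^+ p.-1 * q)) (upd b i y)) = 0.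
    have eqf z : form (a ^+ p * (z ^+ p.-1 * q)) (upd b i z) =
                 (a ^+ p * q) *: (z ^+ p.-1 *: D z).
      by rewrite !scale_form mulr1 -mulrA [q * _]mulrC.
    rewrite !eqf -!scalerBr -(der_witt_sum hp DD DM).
    have -> : (a ^+ p * q) *: D (witt_sum p x y) =
              D ((a ^+ p * q) * witt_sum p x y).
      by rewrite DM DK scaler0 addr0.
    exact: mod_exact_form1.
  move: main; rewrite !raddfB => /eqP; rewrite -addrA -opprD subr_eq0 => /eqP.
  by move=> ->; rewrite form_addr raddfD opprD addrACA.
- rewrite !prod_upd -raddfD; congr (mod_exact _).
  set q := \prod_(l | _) _.
  rewrite !form_mulr opprD addrACA.
  have pE (z : F) : z * z ^+ p.-1 = z ^+ p by rewrite -exprS prednK.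
  congr (form _ _ - _ + (form _ _ - _)).
  - by rewrite !exprMn -(pE x); ring.
  - by rewrite !exprMn -(pE y); ring.
- by rewrite !(form_alt _ il e) subrr raddf0.
Qed.

(* The characteristic hypothesis is what makes [P_gen] well defined on Omega. *)
Definition P_map of p \in [pchar F] : Omega F j -> Omega_mod_exact F j :=
  Omega_lift P_gen.

HB.instance Definition _ := GRing.isZmodMorphism.Build _ _ (P_map hp)
  (Omega_lift_is_zmod_morphism P_gen_form_map).

Lemma P_mapE a b :
  P_map hp (form a b) = mod_exact (form (a ^+ p * \prod_i b i ^+ p.-1) b - form a b).
Proof. by rewrite /P_map (Omega_lift_form P_gen_form_map). Qed.

Lemma P_map_dlog (a : F) (b : {ffun 'I_j -> F}) : (forall i, b i != 0) ->
  P_map hp (dlog_form a b) = mod_exact (dlog_form (a ^+ p - a) b).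
Proof.
move=> b0; rewrite /dlog_form P_mapE -formN -formD; congr (mod_exact (form _ b)).
have p0 : (0 < p)%N := prime_gt0 (pcharf_prime hp).
set c := \prod_i b i.
have c0 : c != 0 by apply/prodf_neq0 => i _; exact: b0.
rewrite prodrXl -/c mulrBl; congr (_ - _); apply: (mulIf c0).
by rewrite divfK // -mulrA -exprSr prednK // -exprMn divfK.
Qed.

(* The dlog forms generate, so this formula determines P. *)
Lemma P_map_unique (f : {additive Omega F j -> Omega_mod_exact F j}) :
  (forall (a : F) (b : {ffun 'I_j -> F}), (forall i, b i != 0) ->
     f (dlog_form a b) = mod_exact (dlog_form (a ^+ p - a) b)) ->
  f =1 P_map hp.
Proof.
move=> hf; apply: Omega_additive_ext => a b.
have [b0|] := boolP [forall i, b i != 0].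
  move/forallP: b0 => b0.
  have c0 : \prod_i b i != 0 by apply/prodf_neq0 => i _; exact: b0.
  have -> : form a b = dlog_form (a * \prod_i b i) b.
    by rewrite /dlog_form mulfK.
  by rewrite hf //= P_map_dlog.
rewrite negb_forall => /existsP[i /negPn/eqP bi0].
suff -> : form a b = 0 by rewrite !raddf0.
have -> : b = upd b i 0.
  by apply/ffunP => l; rewrite ffunE; case: eqP => // ->.
by apply: (addrI (form a (upd b i 0))); rewrite -form_addr !addr0.
Qed.

Lemma P_map_dlog1 (b : {ffun 'I_j -> F}) : (forall i, b i != 0) ->
  P_map hp (dlog_form 1 b) = 0.
Proof.
by move=> b0; rewrite P_map_dlog // expr1n subrr /dlog_form mul0r form0 raddf0.
Qed.

Definition P_ker : {pred Omega F j} := fun x => P_map hp x == 0.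

Lemma P_ker_zmod_closed : zmod_closed P_ker.
Proof.
split=> [|x y /eqP hx /eqP hy]; rewrite unfold_in /=; first by rewrite raddf0.
by rewrite raddfB /= hx hy subr0.
Qed.

HB.instance Definition _ :=
  GRing.isZmodClosed.Build _ P_ker P_ker_zmod_closed.

(* H^{j,j}(F) = ker P *)
Record Hdiag : Type := HDiag { Hdiag_val : Omega F j; _ : Hdiag_val \in P_ker }.

HB.instance Definition _ := [isSub for Hdiag_val].
HB.instance Definition _ := [Choice of Hdiag by <:].
HB.instance Definition _ := [SubChoice_isSubZmodule of Hdiag by <:].

Definition P_im : {pred Omega_mod_exact F j} :=
  fun x => `[< exists y, x = P_map hp y >].

Lemma P_im_zmod_closed : zmod_closed P_im.
Proof.
split=> [|x y /asboolP[z ->] /asboolP[t ->]]; apply/asboolP.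
  by exists 0; rewrite raddf0.
by exists (z - t); rewrite raddfB.
Qed.

HB.instance Definition _ := GRing.isZmodClosed.Build _ P_im P_im_zmod_closed.

(* H^{j+1,j}(F) = coker P *)
Definition Hsucc : zmodType := Quotient.quot P_im.

Definition Hsucc_pi : {additive Omega_mod_exact F j -> Hsucc} :=
  \pi_(Quotient.quot P_im).

End ArtinSchreier.

Section Pullback.
Variables (F E : fieldType) (f : {rmorphism F -> E}) (j : nat).

Definition ffun_map (b : {ffun 'I_j -> F}) : {ffun 'I_j -> E} :=
  [ffun i => f (b i)].

Lemma ffun_map_upd b i x : ffun_map (upd b i x) = upd (ffun_map b) i (f x).
Proof. by apply/ffunP => l; rewrite !ffunE; case: (l == i). Qed.

Definition pull_gen (a : F) (b : {ffun 'I_j -> F}) : Omega E j :=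
  form (f a) (ffun_map b).

Lemma pull_gen_form_map : form_map pull_gen.
Proof.
rewrite /pull_gen; split=> [a a' b|a b i x y|a b i x y|a b i l il e].
- by rewrite rmorphD formD.
- by rewrite !ffun_map_upd rmorphD form_addr.
- by rewrite !ffun_map_upd !rmorphM form_mulr.
- by apply: (form_alt _ il); rewrite !ffunE e.
Qed.

Definition pull : Omega F j -> Omega E j := Omega_lift pull_gen.

HB.instance Definition _ := GRing.isZmodMorphism.Build _ _ pull
  (Omega_lift_is_zmod_morphism pull_gen_form_map).

Lemma pullE a b : pull (form a b) = form (f a) (ffun_map b).
Proof. by rewrite /pull (Omega_lift_form pull_gen_form_map). Qed.

End Pullback.

Arguments pull {F E} f {j}.

Lemma pull_ext_d (F E : fieldType) (f : {rmorphism F -> E}) j (x : Omega F j) :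
  pull f (ext_d x) = ext_d (pull f x).
Proof.
elim/Omega_ind: x => [|a b x ih]; first by rewrite !raddf0.
rewrite !raddfD /= ih; congr (_ + _); rewrite ext_dE !pullE ext_dE rmorph1.
congr form; apply/ffunP => i; rewrite !ffunE.
by case: (unlift ord0 i) => [l|] //; rewrite ffunE.
Qed.

Lemma pull_exact (F E : fieldType) (f : {rmorphism F -> E}) j (x : Omega F j) :
  x \in @exact_forms F j -> pull f x \in @exact_forms E j.
Proof.
case: j x => [|j] x; first by move=> /eqP ->; rewrite raddf0 rpred0.
move=> /asboolP[y ->]; apply/asboolP; exists (pull f y).
exact: pull_ext_d.
Qed.

Section QuotientMap.
Variables (V W : zmodType) (I : zmodClosed V) (J : zmodClosed W).
Variable f : {additive V -> W}.

Definition quot_map (x : Quotient.quot I) : Quotient.quot J :=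
  \pi_(Quotient.quot J) (f (repr x)).

Hypothesis hf : forall x, x \in I -> f x \in J.

Lemma quot_map_pi x :
  quot_map (\pi_(Quotient.quot I) x) = \pi_(Quotient.quot J) (f x).
Proof.
apply/eqP; rewrite -Quotient.idealrBE -raddfB; apply: hf.
by rewrite Quotient.idealrBE reprK.
Qed.

Lemma quot_map_is_zmod_morphism : zmod_morphism quot_map.
Proof.
move=> x y; rewrite -[x]reprK -[y]reprK -raddfB.
by rewrite !quot_map_pi !raddfB.
Qed.

End QuotientMap.

Section PullbackModExact.
Variables (F E : fieldType) (f : {rmorphism F -> E}) (j : nat).

Definition pull_mod : Omega_mod_exact F j -> Omega_mod_exact E j :=
  quot_map (I := @exact_forms F j) (@exact_forms E j) (pull f).

HB.instance Definition _ := GRing.isZmodMorphism.Build _ _ pull_mod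
  (quot_map_is_zmod_morphism (@pull_exact F E f j)).

Lemma pull_mod_exact x : pull_mod (mod_exact x) = mod_exact (pull f x).
Proof. exact: (quot_map_pi (@pull_exact F E f j)). Qed.

Variables (p : nat) (hF : p \in [pchar F]) (hE : p \in [pchar E]).

Lemma pull_P (x : Omega F j) : pull_mod (P_map hF x) = P_map hE (pull f x).
Proof.
elim/Omega_ind: x => [|a b x ih]; first by rewrite !raddf0.
rewrite !raddfD /= ih; congr (_ + _).
rewrite P_mapE pull_mod_exact raddfB /= !pullE P_mapE.
rewrite rmorphM rmorph_prod rmorphXn.
congr (mod_exact (form (_ * _) _ - _)).
by apply: eq_bigr => i _; rewrite rmorphXn ffunE.
Qed.

Lemma pull_P_ker x : x \in P_ker hF (j := j) -> pull f x \in P_ker hE (j := j).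
Proof. by move=> /eqP hx; apply/eqP; rewrite -pull_P hx raddf0. Qed.

Lemma pull_P_im x :
  x \in P_im hF (j := j) -> pull_mod x \in P_im hE (j := j).
Proof.
move=> /asboolP[y ->]; apply/asboolP; exists (pull f y); exact: pull_P.
Qed.

Definition Hdiag_pull (x : Hdiag hF j) : Hdiag hE j :=
  HDiag (pull_P_ker (valP x)).

Lemma Hdiag_pull_is_zmod_morphism : zmod_morphism Hdiag_pull.
Proof. by move=> x y; apply: val_inj; rewrite /= !raddfB. Qed.

HB.instance Definition _ := GRing.isZmodMorphism.Build _ _ Hdiag_pull
  Hdiag_pull_is_zmod_morphism.

Definition Hsucc_pull : Hsucc hF j -> Hsucc hE j :=
  quot_map (I := P_im hF (j := j)) (P_im hE (j := j)) pull_mod.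

HB.instance Definition _ := GRing.isZmodMorphism.Build _ _ Hsucc_pull
  (quot_map_is_zmod_morphism pull_P_im).

Lemma Hsucc_pull_pi x :
  Hsucc_pull (Hsucc_pi hF j x) = Hsucc_pi hE j (pull_mod x).
Proof. exact: (quot_map_pi pull_P_im). Qed.

End PullbackModExact.

Lemma pull_id (F : fieldType) (f : {rmorphism F -> F}) j (x : Omega F j) :
  (forall a, f a = a) -> pull f x = x.
Proof.
move=> hf; elim/Omega_ind: x => [|a b x ih]; first by rewrite raddf0.
rewrite raddfD /= ih pullE hf; congr (form _ _ + _).
by apply/ffunP => i; rewrite ffunE hf.
Qed.

Lemma pull_comp (F E L : fieldType) (f : {rmorphism F -> E})
    (g : {rmorphism E -> L}) (h : {rmorphism F -> L}) j (x : Omega F j) :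
  (forall a, h a = g (f a)) -> pull h x = pull g (pull f x).
Proof.
move=> hh; elim/Omega_ind: x => [|a b x ih]; first by rewrite !raddf0.
rewrite !raddfD /= ih !pullE hh; congr (form _ _ + _).
by apply/ffunP => i; rewrite !ffunE hh.
Qed.

Lemma mod_exact_surj (F : fieldType) j (x : Omega_mod_exact F j) :
  exists y, x = mod_exact y.
Proof.
by exists (repr (x : Quotient.quot (@exact_forms F j)));
  apply: esym; exact: reprK.
Qed.

Lemma Hsucc_pi_surj (F : fieldType) p (hp : p \in [pchar F]) j
  (x : Hsucc hp j) : exists y, x = Hsucc_pi hp j y.
Proof.
by exists (repr (x : Quotient.quot (P_im hp (j := j))));
  apply: esym; exact: reprK.
Qed.

Record field_over (k : fieldType) := FieldOver {
  fo_field :> fieldType;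
  fo_map : {rmorphism k -> fo_field} }.

Record over_hom (k : fieldType) (K L : field_over k) := OverHom {
  over_fun :> {rmorphism K -> L};
  over_comm : forall a, over_fun (fo_map K a) = fo_map L a }.

Section Category.
Variable k : fieldType.

Definition over_id (K : field_over k) : over_hom K K :=
  @OverHom k K K idfun (fun=> erefl).

Lemma over_comp_comm (K L M : field_over k) (g : over_hom L M)
  (f : over_hom K L) a : (g \o f) (fo_map K a) = fo_map M a.
Proof. by rewrite /= !over_comm. Qed.

Definition over_comp (K L M : field_over k) (g : over_hom L M)
    (f : over_hom K L) : over_hom K M :=
  @OverHom k K M (g \o f) (over_comp_comm g f).

Definition base_field : field_over k := @FieldOver k k idfun.

Definition base_hom (K : field_over k) : over_hom base_field K :=
  @OverHom k base_field K (fo_map K) (fun=> erefl).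

Record field_functor := FieldFunctor {
  fobj :> field_over k -> zmodType;
  fmap : forall K L : field_over k, over_hom K L -> {additive fobj K -> fobj L};
  fmap_id : forall (K : field_over k) (x : fobj K), fmap (over_id K) x = x;
  fmap_comp : forall (K L M : field_over k) (g : over_hom L M)
    (f : over_hom K L) (x : fobj K),
    fmap (over_comp g f) x = fmap g (fmap f x) }.

(* Naturality only for the underlying functors to sets: no additivity. *)
Record operation (A B : field_functor) := Operation {
  op_fun :> forall K : field_over k, A K -> B K;
  op_natural : forall (K L : field_over k) (f : over_hom K L) (x : A K),
    op_fun (fmap A f x) = fmap B f (op_fun x) }.

Definition constant_operation (A B : field_functor) (T : operation A B) : Prop :=
  exists c : B base_field,
    forall (K : field_over k) (x : A K), T K x = fmap B (base_hom K) c.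

Definition normalized_operation (A B : field_functor) (T : operation A B) :
  Prop := forall K : field_over k, T K 0 = 0.

Variables (p : nat) (hp : p \in [pchar k]).

Definition fo_pchar (K : field_over k) : p \in [pchar K] :=
  rmorph_pchar (fo_map K) hp.

Section Diag.
Variable j : nat.

Definition Hdiag_obj (K : field_over k) : zmodType := Hdiag (fo_pchar K) j.

Definition Hdiag_fmap (K L : field_over k) (f : over_hom K L) :
    {additive Hdiag_obj K -> Hdiag_obj L} :=
  @Hdiag_pull K L f j p (fo_pchar K) (fo_pchar L).

Lemma Hdiag_fmap_id K x : Hdiag_fmap (over_id K) x = x.
Proof. by apply: val_inj; rewrite /= pull_id. Qed.

Lemma Hdiag_fmap_comp K L M (g : over_hom L M) (f : over_hom K L) x :
  Hdiag_fmap (over_comp g f) x = Hdiag_fmap g (Hdiag_fmap f x).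
Proof. by apply: val_inj => /=; exact: pull_comp. Qed.

Definition H_diag : field_functor :=
  FieldFunctor Hdiag_fmap_id Hdiag_fmap_comp.

Definition Hsucc_fmap (K L : field_over k) (f : over_hom K L) :
    {additive Hsucc (fo_pchar K) j -> Hsucc (fo_pchar L) j} :=
  @Hsucc_pull K L f j p (fo_pchar K) (fo_pchar L).

Lemma Hsucc_fmap_pi K L (f : over_hom K L) x :
  Hsucc_fmap f (Hsucc_pi (fo_pchar K) j (mod_exact x)) =
  Hsucc_pi (fo_pchar L) j (mod_exact (pull f x)).
Proof. by rewrite /= Hsucc_pull_pi pull_mod_exact. Qed.

Lemma Hsucc_fmap_id K x : Hsucc_fmap (over_id K) x = x.
Proof.
have [y ->] := Hsucc_pi_surj x; have [z ->] := mod_exact_surj y.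
by rewrite Hsucc_fmap_pi pull_id.
Qed.

Lemma Hsucc_fmap_comp K L M (g : over_hom L M) (f : over_hom K L) x :
  Hsucc_fmap (over_comp g f) x = Hsucc_fmap g (Hsucc_fmap f x).
Proof.
have [y ->] := Hsucc_pi_surj x; have [z ->] := mod_exact_surj y.
by rewrite !Hsucc_fmap_pi (pull_comp (f := f) (g := g)).
Qed.

Definition H_succ : field_functor :=
  FieldFunctor Hsucc_fmap_id Hsucc_fmap_comp.

End Diag.
End Category.

(* Main.v *)
Require Import Defs.
From mathcomp Require Import all_boot all_order all_algebra.
From mathcomp Require Import perm falgebra fieldext separable boolp.
Require Import Defs.

Set Implicit Arguments.
Unset Strict Implicit.
Unset Printing Implicit Defensive.

Import GRing.Theory.
Local Open Scope ring_scope.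

(** The idea is that classes in [H^{m+1,m}] die in separable extensions, while
forms survive there.

Let [x] be a class over [K], represented by a sum of forms
[a dlog b_1 /\ ... /\ dlog b_m].  Over an extension containing a root [z] of
[z^p - z = a], such a form is the image under the Artin-Schreier operator of
[z dlog b_1 /\ ... /\ dlog b_m].  Adjoining one root per summand gives an
extension [L] of [K] in which [x] becomes zero ([splitting_extension]).  By
naturality an operation [T] then takes, over [L], the same value on [x] as on
[0], and the latter comes from [c = T 0] over the base field.  So [T x] and the
pullback of [c] to [K] agree after pullback to [L], and it remains to see that
[Omega^r_K -> Omega^r_L] is injective.

Each step of the tower is a finite separable extension [L = K(z)], for which
there is even an additive retraction [Omega^r_L -> Omega^r_K].  Separability
gives [K(z^p) = L], so that the p-th powers [w_k] of a basis [v_k] of [L] again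
form a basis; its structure constants are the p-th powers of those of [v_k] and
are therefore killed by [d].  Consequently expanding elements of [L] in the
basis [w_k] and treating the [w_k] as constants respects the Leibniz rule:
[d (sum_k x_k w_k) = sum_k w_k dx_k] defines a derivation, and by multilinear
expansion a map from [Omega^r_L] to the tensor product of [L] and [Omega^r_K]
over [K].  Taking the coefficient of [w_0 = 1] retracts the pullback
([retract_pull], [separable_pull_inj]). *)

(** * Symbols in the module of forms *)

Section Forms.
Variables (F : fieldType) (j : nat).
Implicit Types (b : {ffun 'I_j -> F}) (i l : 'I_j).

Lemma form_entry0 a b i : b i = 0 -> form a b = 0.
Proof.
move=> bi0; have -> : b = upd b i 0.
  by apply/ffunP => l; rewrite ffunE; case: eqP => // ->.
by apply: (addrI (form a (upd b i 0))); rewrite -form_addr !addr0.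
Qed.

Lemma form_updX p a b i x :
  p \in [pchar F] -> form a (upd b i (x ^+ p)) = 0.
Proof.
move=> hp; have Dmul z t : form 1 (upd b i (z * t)) =
    z *: form 1 (upd b i t) + t *: form 1 (upd b i z).
  by rewrite form_mulr !scale_form !mulr1 !mul1r.
by rewrite -[a]mulr1 -scale_form (derX_pchar hp Dmul) scaler0.
Qed.

(** Polarization: the symbol with [b i + b l] in both slots [i] and [l]
vanishes. *)
Lemma form_tperm a b i l : i != l ->
  form a [ffun s => b (tperm i l s)] = - form a b.
Proof.
move=> il; pose U x y := upd (upd b i x) l y.
have Ui x y : U x y = upd (upd b l y) i x.
  apply/ffunP => s; rewrite !ffunE; case: (eqVneq s l) => // ->.
  by rewrite eq_sym (negPf il).
have U0 x : form a (U x x) = 0.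
  by apply: (form_alt _ il); rewrite !ffunE !eqxx (negPf il).
have UDl x x' y : form a (U (x + x') y) = form a (U x y) + form a (U x' y).
  by rewrite !Ui form_addr.
have := U0 (b i + b l); rewrite UDl !form_addr -!/(U _ _) !U0 add0r addr0.
have -> : U (b i) (b l) = b.
  by apply/ffunP => s; rewrite !ffunE; do 2?case: eqP => [->|_] //.
move/eqP; rewrite addrC addr_eq0 => /eqP <-; congr form.
apply/ffunP => s; rewrite !ffunE; case: tpermP => [->|->|/eqP si /eqP sl].
- by rewrite (negPf il) eqxx.
- by rewrite eqxx.
- by rewrite (negPf si) (negPf sl).
Qed.

(** A symbol with nonzero entries is a logarithmic form, and a symbol with a
zero entry vanishes, so logarithmic forms generate [Omega]. *)
Lemma Omega_dlog_ind (P : Omega F j -> Prop) :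
  P 0 ->
  (forall (a : F) b x, (forall i, b i != 0) -> P x ->
     P (dlog_form a b + x)) ->
  forall x, P x.
Proof.
move=> P0 PD; elim/Omega_ind => // a b x Px.
have [/forallP b0|] := boolP [forall i, b i != 0].
  have c0 : \prod_i b i != 0 by apply/prodf_neq0 => i _; exact: b0.
  have -> : form a b = dlog_form (a * \prod_i b i) b.
    by rewrite /dlog_form mulfK.
  exact: PD.
rewrite negb_forall => /existsP[i /negPn/eqP bi0].
by rewrite (form_entry0 a bi0) add0r.
Qed.

End Forms.

(** * A retraction of forms along a basis with p-th power structure constants *)

Definition set_at r (J : finType) (phi : {ffun 'I_r -> J}) i k :
  {ffun 'I_r -> J} := [ffun l => if l == i then k else phi l].

(** Isolates the index in slot [i] of a multi-index sum: the outer sum fixes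
that slot to the arbitrary value [k0] and so runs over the remaining slots. *)
Lemma sum_set_at (V : zmodType) r (J : finType) (k0 : J) (i : 'I_r)
  (G : {ffun 'I_r -> J} -> V) :
  \sum_phi G phi =
  \sum_(phi : {ffun 'I_r -> J} | phi i == k0) \sum_k G (set_at phi i k).
Proof.
rewrite (partition_big (fun phi => set_at phi i k0)
  (fun phi : {ffun _} => phi i == k0)).
  2: by move=> phi _; rewrite ffunE eqxx.
apply: eq_bigr => psi /eqP psi0.
rewrite (reindex_onto (set_at psi i) (fun phi : {ffun _} => phi i)) /=.
  apply: eq_bigl => k; rewrite ffunE eqxx eqxx andbT; apply/eqP/ffunP => l.
  by rewrite !ffunE; case: eqP => // ->; rewrite psi0.
move=> phi /eqP <-; apply/ffunP => l; rewrite !ffunE.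
by case: eqP => // ->.
Qed.

Section Retraction.
Variables (p : nat) (K L : fieldType) (f : {rmorphism K -> L}) (n : nat).
Hypothesis hp : p \in [pchar K].
Variables (w : 'I_n.+1 -> L) (mu : 'I_n.+1 -> {additive L -> K}).
Variable g : 'I_n.+1 -> 'I_n.+1 -> 'I_n.+1 -> K.
Hypothesis muZ : forall k c x, mu k (f c * x) = c * mu k x.
Hypothesis mu_sum : forall x, x = \sum_k f (mu k x) * w k.
Hypothesis mu1 : forall k, mu k 1 = (k == ord0)%:R.
Hypothesis muM : forall k s t, mu k (w s * w t) = g s t k ^+ p.
Variable r : nat.

(** The coefficient of [w ord0] in the expansion of [c db_1 /\ ... /\ db_r],
where [b_i = sum_k mu_k(b_i) w_k] and the [w_k] are treated as constants. *)
Definition retract_gen (c : L) (b : {ffun 'I_r -> L}) : Omega K r :=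
  \sum_(phi : {ffun 'I_r -> 'I_n.+1})
    form (mu ord0 (c * \prod_i w (phi i))) [ffun i => mu (phi i) (b i)].

Lemma coord_mul k x y :
  mu k (x * y) = \sum_s \sum_t mu s x * (mu t y * g s t k ^+ p).
Proof.
rewrite {1}(mu_sum x) {1}(mu_sum y) mulr_suml raddf_sum; apply: eq_bigr => s _.
rewrite mulr_sumr raddf_sum; apply: eq_bigr => t _ /=.
by rewrite -mulrA [w s * _]mulrCA !muZ muM.
Qed.

(** The slot-[i] expansion reduces the axioms of a form map that concern slot
[i] to identities for a single sum over [k], the other slots being fixed. *)
Lemma retract_gen_upd c b i z :
  retract_gen c (upd b i z) =
  \sum_(phi : {ffun 'I_r -> 'I_n.+1} | phi i == ord0) \sum_k
    form (mu ord0 (c * (\prod_(l | l != i) w (phi l)) * w k))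
      (upd [ffun l => mu (phi l) (b l)] i (mu k z)).
Proof.
rewrite /retract_gen (sum_set_at ord0 i); apply: eq_bigr => phi _.
apply: eq_bigr => k _; congr form.
  rewrite (bigD1 i) //= ffunE eqxx [w k * _]mulrC mulrA.
  congr (mu _ (_ * _ * _)); apply: eq_bigr => l /negPf li.
  by rewrite ffunE li.
by apply/ffunP => l; rewrite !ffunE; case: eqP.
Qed.

(** The Leibniz rule in one slot, where [D a z] stands for the form [a dz] with
the other slots fixed.  The structure constants pass through [D] because they
are p-th powers, and then recombine with the [w k] into [w s * w t]. *)
Lemma twisted_leibniz (V : zmodType) (D : K -> K -> V) (C x y : L) :
  (forall a a' z, D (a + a') z = D a z + D a' z) ->
  (forall a z z', D a (z + z') = D a z + D a z') ->
  (forall a z z', D a (z * z') = D (a * z) z' + D (a * z') z) ->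
  (forall a z, D a (z ^+ p) = 0) ->
  \sum_k D (mu ord0 (C * w k)) (mu k (x * y)) =
  \sum_k D (mu ord0 (C * x * w k)) (mu k y) +
  \sum_k D (mu ord0 (C * y * w k)) (mu k x).
Proof.
move=> DDl DDr DM DX.
have D0l z : D 0 z = 0 by apply: (addrI (D 0 z)); rewrite -DDl !addr0.
have D0r a : D a 0 = 0 by apply: (addrI (D a 0)); rewrite -DDr !addr0.
have Dsl I (s : seq I) h z : D (\sum_(t <- s) h t) z = \sum_(t <- s) D (h t) z.
  exact: (big_morph (D ^~ z) (fun a a' => DDl a a' z) (D0l z)).
have Dsr I (s : seq I) h a : D a (\sum_(t <- s) h t) = \sum_(t <- s) D a (h t).
  exact: (big_morph (D a) (DDr a) (D0r a)).
have wM s t : w s * w t = \sum_k f (g s t k ^+ p) * w k.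
  by rewrite [LHS]mu_sum; apply: eq_bigr => k _; rewrite muM.
have muC c s t : mu ord0 (C * f c * w s * w t) =
    \sum_k mu ord0 (C * w k) * (c * g s t k ^+ p).
  rewrite -mulrA wM mulr_sumr raddf_sum; apply: eq_bigr => k _ /=.
  have -> : C * f c * (f (g s t k ^+ p) * w k) =
      f (c * g s t k ^+ p) * (C * w k).
    by rewrite rmorphM -!mulrA mulrCA; congr (_ * _); rewrite mulrCA.
  by rewrite muZ mulrC.
have muCx z t : mu ord0 (C * z * w t) =
    \sum_s \sum_k mu ord0 (C * w k) * (mu s z * g s t k ^+ p).
  rewrite {1}(mu_sum z) mulr_sumr mulr_suml raddf_sum.
  by apply: eq_bigr => s _; rewrite -muC mulrA.
have gC s t k : g s t k ^+ p = g t s k ^+ p by rewrite -!muM mulrC.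
under eq_bigr do [rewrite (coord_mul _ x) Dsr; under eq_bigr do rewrite Dsr].
have e k s t : D (mu ord0 (C * w k)) (mu s x * (mu t y * g s t k ^+ p)) =
    D (mu ord0 (C * w k) * (mu s x * g s t k ^+ p)) (mu t y) +
    D (mu ord0 (C * w k) * (mu t y * g t s k ^+ p)) (mu s x).
  by rewrite DM DM DX add0r [g t s k ^+ p]gC -[_ * mu s x * _]mulrA.
under eq_bigr do under eq_bigr do
  [under eq_bigr do rewrite e; rewrite big_split /=].
under eq_bigr do rewrite big_split /=.
rewrite big_split /=; congr (_ + _).
  rewrite exchange_big /=.
  under [RHS]eq_bigr do
    [rewrite muCx Dsl; under eq_bigr do rewrite Dsl].
  rewrite [RHS]exchange_big /=; apply: eq_bigr => s _.
  by rewrite exchange_big.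
under [RHS]eq_bigr do
  [rewrite muCx Dsl; under eq_bigr do rewrite Dsl].
rewrite exchange_big /=; apply: eq_bigr => s _.
by rewrite exchange_big.
Qed.

Lemma retract_gen_form_map : form_map retract_gen.
Proof.
split=> [c c' b|c b i x y|c b i x y|c b i l il e].
- rewrite /retract_gen -big_split; apply: eq_bigr => phi _ /=.
  by rewrite mulrDl raddfD formD.
- rewrite !retract_gen_upd -big_split; apply: eq_bigr => phi _ /=.
  rewrite -big_split; apply: eq_bigr => k _ /=.
  by rewrite raddfD form_addr.
- rewrite !retract_gen_upd -big_split; apply: eq_bigr => phi _ /=.
  set W := \prod_(_ | _) _; set B := [ffun _ => _].
  rewrite [c * x * W]mulrAC [c * y * W]mulrAC.
  apply: (twisted_leibniz (D := fun a z => form a (upd B i z))).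
  + by move=> *; exact: formD.
  + by move=> *; exact: form_addr.
  + by move=> *; exact: form_mulr.
  + by move=> *; exact: form_updX.
(* The terms with equal indices in slots [i] and [l] vanish, and the others
   cancel in pairs under the swap of these slots; splitting by [phi i < phi l]
   makes the cancellation valid also when [p = 2]. *)
pose swap (phi : {ffun 'I_r -> 'I_n.+1}) := [ffun s => phi (tperm i l s)].
have swapK : involutive swap.
  by move=> phi; apply/ffunP => s; rewrite !ffunE tpermK.
rewrite /retract_gen; set G := BIG_F.
have Gswap phi : G (swap phi) = - G phi.
  rewrite /G -(form_tperm _ _ il); congr form.
    congr (mu _ (_ * _)); rewrite [RHS](reindex_inj (@perm_inj _ (tperm i l))).
    by apply: eq_bigr => s _; rewrite ffunE.
  apply/ffunP => s; rewrite !ffunE; congr (mu _ _).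
  by case: tpermP => // ->.
rewrite (bigID (fun phi : {ffun _} => phi i == phi l)) /= big1 ?add0r.
  2: by move=> phi /eqP eil; apply: (form_alt _ il); rewrite !ffunE eil e.
rewrite (bigID (fun phi : {ffun 'I_r -> 'I_n.+1} => (phi i < phi l)%N)) /=.
rewrite [X in _ + X](reindex_inj (inv_inj swapK)) /=.
under [X in _ + X]eq_bigr do rewrite Gswap.
rewrite sumrN; apply/eqP; rewrite subr_eq0; apply/eqP.
apply: eq_bigl => phi; rewrite !ffunE tpermL tpermR -leqNgt ltn_neqAle.
by rewrite (eq_sym (phi l)) andbA andbb.
Qed.

Lemma coord_base k c : mu k (f c) = c * (k == ord0)%:R.
Proof. by rewrite -[f c]mulr1 muZ mu1. Qed.

(** Elements of [K] have coordinate zero along [w k] for [k != ord0], so a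
symbol pulled back from [K] only meets the constant multi-index [ord0]. *)
Lemma retract_pull x : Omega_lift retract_gen (pull f x : Omega L r) = x.
Proof.
elim/Omega_ind: x => [|a b x ih].
  by rewrite raddf0 (Omega_lift0 retract_gen_form_map).
rewrite raddfD (Omega_liftD retract_gen_form_map) ih; congr (_ + _).
rewrite /= pullE (Omega_lift_form retract_gen_form_map) /retract_gen.
rewrite (bigD1 [ffun=> ord0]) //= [X in _ + X]big1 ?addr0 => [|phi phi0].
  have w0 : w ord0 = 1.
    rewrite [RHS]mu_sum (bigD1 ord0) //= mu1 rmorph1 mul1r big1 ?addr0 //.
    by move=> k /negPf k0; rewrite mu1 k0 rmorph0 mul0r.
  rewrite big1 => [|i _]; last by rewrite ffunE.
  rewrite mulr1 coord_base eqxx mulr1; congr form.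
  by apply/ffunP => i; rewrite !ffunE coord_base eqxx mulr1.
have [i phii] : exists i, phi i != ord0.
  apply/existsP; rewrite -negb_forall; apply: contra phi0 => /forallP h.
  by apply/eqP/ffunP => i; rewrite ffunE; apply/eqP.
apply: (form_entry0 _ (i := i)).
by rewrite !ffunE coord_base (negPf phii) mulr0.
Qed.

Lemma pull_inj_basis : injective (pull f : Omega K r -> Omega L r).
Proof. exact: (can_inj retract_pull). Qed.

End Retraction.

(** * Injectivity of pullback along separable extensions *)

Section SeparableExtension.
Variables (p : nat) (K : fieldType) (L : fieldExtType K).
Hypothesis hp : p \in [pchar K].

Let hpL : p \in [pchar L] := rmorph_pchar (in_alg L) hp.

(** The span of the [v_i^p] contains every p-th power, in particular the powers
of [z^p], and these generate [L] because [z] is separable. *)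
Lemma pth_powers_span n (v : n.-tuple L) (z : L) :
  span v = fullv -> <<1; z>>%VS = fullv -> separable_element 1 z ->
  span [seq x ^+ p | x <- v] = fullv.
Proof.
move=> vT zT sz; set S := span _.
have powS x : x ^+ p \in S.
  have : x \in span v by rewrite vT memvf.
  move=> /coord_span ->; rewrite -(pFrobenius_autE hpL) raddf_sum memv_suml //.
  move=> i _; rewrite /= pFrobenius_autE exprZn rpredZ // memv_span //.
  by apply/map_f; rewrite mem_nth // size_tuple.
apply/eqP; rewrite eqEsubv subvf; apply/subvP => x _.
have : x \in <<1; z ^+ p>>%VS.
  apply: (subvP _ x (memvf x)); rewrite -zT.
  apply/FadjoinP; split; first exact: subv_adjoin.
  by rewrite -[p]expn1 -(pcharf_p_separable 1 _ 0 hpL).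
case/Fadjoin_polyP => q q1 ->; rewrite horner_coef memv_suml // => i _.
have /vlineP[c ->] := polyOverP q1 i.
by rewrite mulr_algl rpredZ // exprAC powS.
Qed.

Lemma basis_with_one :
  exists n (v : n.+1.-tuple L), basis_of fullv v /\ tnth v ord0 = 1.
Proof.
pose U : {vspace L} := (1^C)%VS; exists (\dim U), (cons_tuple 1 (vbasis U)).
split=> //=; rewrite -(addv_complf 1%VS) -cat1s; apply: cat_basis.
- by apply/directv_addP; exact: capv_compl.
- by apply: seq1_basis; exact: oner_neq0.
- exact: vbasisP.
Qed.

(** Raising [v_s v_t = sum_k c_k v_k] to the p-th power shows that the structure
constants of the basis [v_k^p] are the [c_k^p]. *)
Lemma separable_pull_inj (z : L) r :
  <<1; z>>%VS = fullv -> separable_element 1 z ->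
  injective (pull (in_alg L) : Omega K r -> Omega L r).
Proof.
move=> zT sz; have [n [v [vB v0]]] := basis_with_one.
pose w := map_tuple (fun x => x ^+ p) v.
have wB : basis_of fullv w.
  rewrite basisEdim (pth_powers_span (span_basis vB) zT sz) subvv /=.
  by rewrite (size_basis vB) size_tuple.
have w0 : tnth w ord0 = 1 by rewrite tnth_map v0 expr1n.
have cw k i : coord w k (tnth w i) = (i == k)%:R.
  by rewrite (tnth_nth 0) coord_free // (basis_free wB).
have vX (i : 'I_n.+1) : v`_i ^+ p = tnth w i by rewrite tnth_map (tnth_nth 0).
apply: (@pull_inj_basis p K L (in_alg L) n hp (tnth w)
  (fun k => coord w k : {additive L -> K})
  (fun s t k => coord v k (tnth v s * tnth v t))).
- by move=> k c x; rewrite /= mulr_algl linearZ.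
- move=> x; rewrite {1}(coord_basis wB (memvf x)).
  by apply: eq_bigr => k _; rewrite /= mulr_algl (tnth_nth 0).
- by move=> k; have := cw k ord0; rewrite w0 eq_sym.
move=> k s t; rewrite !tnth_map -exprMn.
rewrite {1}(coord_basis vB (memvf (tnth v s * tnth v t))).
rewrite -(pFrobenius_autE hpL) raddf_sum /= linear_sum /= (bigD1 k) //=.
rewrite big1 => [|i ik]; rewrite pFrobenius_autE exprZn linearZ /=.
  by rewrite vX cw eqxx mulr1 addr0.
by rewrite vX cw (negPf ik) mulr0.
Qed.

End SeparableExtension.

(** * Artin-Schreier extensions *)

Lemma irreducible_factor (F : fieldType) (h : {poly F}) :
  (1 < size h)%N -> exists2 q, irreducible_poly q & q %| h.
Proof.
have [n] := ubnP (size h); elim: n h => // n ih h hn h1.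
have [irr|nirr] := pselect (irreducible_poly h); first by exists h.
have [d d1 [dh nd]] :
    exists2 d : {poly F}, size d != 1 & (d %| h) /\ ~ (d %= h).
  apply: contrapT => nd; apply: nirr; split=> // d d1 dh.
  by apply: contrapT => ndh; apply: nd; exists d.
have h0 : h != 0 by rewrite -size_poly_gt0 ltnW.
have dlt : (size d < size h)%N.
  rewrite ltn_neqAle dvdp_leq // andbT.
  by rewrite dvdp_size_eqp //; apply/negP.
have d0 : d != 0 by apply: contraNneq h0 => d0; rewrite d0 dvd0p in dh.
have [||q qi qd] := ih d.
- exact: leq_trans dlt _.
- by rewrite ltn_neqAle eq_sym d1 size_poly_gt0.
by exists q => //; exact: dvdp_trans qd dh.
Qed.

(** Adjoining a root of any irreducible factor of ['X^p - 'X - a] is enough: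
this polynomial has derivative [-1], so each of its roots is separable. *)
Lemma artin_schreier_extension (p : nat) (K : fieldType) (a : K) r :
  p \in [pchar K] ->
  exists (L : fieldType) (f : {rmorphism K -> L}) (z : L),
    z ^+ p - z = f a /\ injective (pull f : Omega K r -> Omega L r).
Proof.
move=> hp; have p1 : (1 < p)%N := prime_gt1 (pcharf_prime hp).
pose h : {poly K} := 'X^p - 'X - a%:P.
have hsize : size h = p.+1.
  rewrite /h -addrA size_polyDl ?size_polyXn // -opprD size_polyN.
  by rewrite size_XaddC.
have [|q qi qh] := irreducible_factor (h := h); first by rewrite hsize ltnW.
have [L _ [z qz zT]] := irredp_FAdjoin qi.
have hz : root (map_poly (in_alg L) h) z.
  by apply: root_dvdp qz; rewrite dvdp_map.
exists L, (in_alg L), z; split.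
  move: hz; rewrite /root /h !rmorphB /= map_polyXn map_polyX map_polyC /=.
  by rewrite !hornerE subr_eq0 => /eqP.
apply: (separable_pull_inj hp zT); apply/separable_elementP.
exists (map_poly (in_alg L) h); split=> //.
  by apply/polyOverP => i; rewrite coef_map /= rpredZ ?mem1v.
rewrite separable_map unlock /h !derivB derivXn derivX derivC subr0.
rewrite -mulr_natr -polyC_natr (pcharf0 hp) mulr0 sub0r.
by rewrite -[X in coprimep _ X]scaleN1r coprimepZr ?oppr_eq0 ?oner_eq0 //
  coprimep1.
Qed.

(** * Operations *)

Lemma dlog_form_P_im (p : nat) (E : fieldType) (hp : p \in [pchar E]) m
    (z : E) (b : {ffun 'I_m -> E}) : (forall i, b i != 0) ->
  mod_exact (dlog_form (z ^+ p - z) b) \in P_im hp (j := m).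
Proof.
by move=> b0; apply/asboolP; exists (dlog_form z b); rewrite P_map_dlog.
Qed.

Lemma pull_dlog_form (K L : fieldType) (f : {rmorphism K -> L}) m
    (a : K) (b : {ffun 'I_m -> K}) :
  pull f (dlog_form a b) = dlog_form (f a) (ffun_map f b).
Proof.
rewrite /dlog_form pullE fmorph_div rmorph_prod; congr (form (_ / _) _).
by apply: eq_bigr => i _; rewrite ffunE.
Qed.

(** Induction on the number of logarithmic forms in [x]: over the extension [E]
splitting the remaining summands, one further root splits the last one. *)
Lemma splitting_extension (p : nat) (K : fieldType) (hp : p \in [pchar K]) m r
    (x : Omega K m) :
  exists (L : fieldType) (f : {rmorphism K -> L}),
    injective (pull f : Omega K r -> Omega L r) /\
    forall hL : p \in [pchar L], mod_exact (pull f x) \in P_im hL (j := m).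
Proof.
elim/Omega_dlog_ind: x => [|a b x b0 [E [f [finj fx]]]].
  exists K, idfun; split=> [x y|hK]; first by rewrite !pull_id.
  by rewrite !raddf0 rpred0.
have hE := rmorph_pchar f hp.
have [L [g [z [hz ginj]]]] := artin_schreier_extension (f a) r hE.
exists L, (g \o f).
have gf j (y : Omega K j) : pull (g \o f) y = pull g (pull f y).
  exact: pull_comp.
split=> [y y'|hL]; first by rewrite !gf => /ginj /finj.
rewrite gf !raddfD rpredD //=.
  rewrite !pull_dlog_form -hz dlog_form_P_im // => i.
  by rewrite !ffunE !fmorph_eq0.
by rewrite -pull_mod_exact; apply: (@pull_P_im E L g m p hE hL); exact: fx.
Qed.

(** Both sides agree over an extension of [K] that kills [x] and on which the
pullback of [r]-forms is injective. *)
Lemma operation_eq0_value (k : fieldType) (p : nat) (hp : p \in [pchar k])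
    (m r : nat) (T : operation (H_succ hp m) (H_diag hp r))
    (K : field_over k) (x : H_succ hp m K) :
  T K x = fmap (H_diag hp r) (base_hom K) (T (base_field k) 0).
Proof.
have [y ->] := Hsucc_pi_surj x; have [w ->] := mod_exact_surj y.
have [L [f [finj fw]]] := splitting_extension (fo_pchar hp K) r w.
pose LK : field_over k := @FieldOver k L (f \o fo_map K).
pose h : over_hom K LK := @OverHom k K LK f (fun=> erefl).
have x0 : fmap (H_succ hp m) h
    (Hsucc_pi (fo_pchar hp K) m (mod_exact w)) = 0.
  apply: etrans (Hsucc_fmap_pi hp h w) _; apply/eqP.
  rewrite -(raddf0 (Hsucc_pi (fo_pchar hp LK) m)) -Quotient.idealrBE subr0.
  exact: fw.
have hinj : injective (fmap (H_diag hp r) h).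
  by move=> u v /(congr1 val) /finj /val_inj.
apply: hinj; rewrite -op_natural x0 -fmap_comp -op_natural.
by rewrite raddf0.
Qed.

Theorem theorem8p3 (k : fieldType) (p : nat) (hp : p \in [pchar k])
    (m r : nat) :
  (forall T : operation (H_succ hp m) (H_diag hp r), constant_operation T) /\
  (forall T : operation (H_succ hp m) (H_diag hp r), normalized_operation T ->
     forall (K : field_over k) (x : H_succ hp m K), T K x = 0).
Proof.
split=> [T|T T0 K x].
  by exists (T (base_field k) 0) => K x; exact: operation_eq0_value.
by rewrite operation_eq0_value T0 raddf0.
Qed.
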